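(* Let $X$ and $Y$ be proper geodesic Gromov hyperbolic spaces, let $\kappa$ be a sublinear function, and let $\Phi:X\to Y$ be a quasi-isometry. Fix $o\in X$ and let $o'\in Y$. If the same admissible exponent $\theta>0$ is used on both logarithmic boundaries, then the induced map $$\Phi_*:(\partial_\kappa X,d^X_{o,\theta})\longrightarrow(\partial_\kappa Y,d^Y_{o',\theta})$$ is bi-Lipschitz.
   Context: The following is for a proper geodesic hyperbolic space $X$ with basepoint $o$, and likewise for $Y$ with basepoint $o'$. $A\asymp B$ means that there is a constant $c\ge1$, independent of the boundary points, with $c^{-1}B\le A\le cB$. Hyperbolic spaces and boundary. In a metric space, $(x\mid y)_p=\frac12(d(x,p)+d(y,p)-d(x,y))$. $X$ is $\delta$-hyperbolic if $(x\mid z)_p\ge\min\{(x\mid y)_p,(y\mid z)_p\}-\delta$ for all points; it is Gromov hyperbolic if this holds for some $\delta\ge 0$ (fixed). A $(q,Q)$-quasi-geodesic ($q\ge1,Q\ge0$) is a continuous map $\beta:I\to X$, $I\subseteq\mathbb R$ an interval, with $\frac1q|s-t|-Q\le d(\beta(s),\beta(t))\le q|s-t|+Q$. All quasi-geodesic rays ($I=[0,\infty)$) start at $o$. The visual boundary $\partial_\infty X$ is the set of quasi-geodesic rays from $o$ modulo finite Hausdorff distance of images; every class contains a geodesic ray. Sublinear Morse boundary. A sublinear function is $\kappa:[0,\infty)\to[1,\infty)$, increasing (non-strictly), concave, $\kappa(r)/r\to0$ as $r\to\infty$. Write $\|x\|=d(o,x)$. For closed $Z\subseteq X$, $\mathcal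 N_\kappa(Z,n)=\{x: d(x,Z)\le n\,\kappa(\|x\|)\}$. For a quasi-geodesic ray $\beta$ and $r>0$, $t_r=\min\{t:\|\beta(t)\|=r\}$, $\beta_r=\beta(t_r)$, $\beta|_r=\beta([0,t_r])$. A closed set $Z$ is $\kappa$-Morse if there is a proper function $m_Z:[1,\infty)\times[0,\infty)\to[0,\infty)$ such that every $(q,Q)$-quasi-geodesic segment with endpoints on $Z$ lies in $\mathcal N_\kappa(Z,m_Z(q,Q))$. $\partial_\kappa X$ is the set of quasi-geodesic rays from $o$ with $\kappa$-Morse image, modulo $\alpha\sim\beta\iff d(\alpha_r,\beta_r)/r\to0$, with the topology generated by the sets $\mathcal U_\kappa$ below. For hyperbolic $X$, sending the class of a geodesic ray from $o$ in $\partial_\infty X$ to its class in $\partial_\kappa X$ is a well-defined homeomorphism, used to identify $\partial_\infty X=\partial_\kappa X$. Fellow-traveling radius. Fix $H(\delta,q,Q)$, depending only on $\delta,q,Q$ (Morse lemma), such that every $(q,Q)$-quasi-geodesic segment with endpoints on a geodesic lies in the $H$-neighborhood of it, and every $(q,Q)$-quasi-geodesic ray from $o$ lies in the $H$-neighborhood of any geodesic ray from $o$ representing the same boundary point. Put $M(q,Q)=\max\{q,Q,H(\delta,3q,3Q),3H(\delta,q,Q)+30\delta\}$. For a geodesic ray $\alpha_0$ from $o$ and $r>0$, $\mathcal U_\kappa(\alpha_0,r)$ is the set of boundary points $b$ such that every $(q,Q)$-quasi-geodesic ray $\beta\in b$ with $M(q,Q)<\frac{r}{24\kappa(r)}$ satisfies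 $\beta|_r\subseteq\mathcal N_\kappa(\alpha_0,M(q,Q))$. Fix for each boundary point a geodesic representative from $o$. For distinct $a,b$ with representatives $\alpha_0,\beta_0$, $r_o(a,b)=\min\{\sup\{r>0:a\in\mathcal U_\kappa(\beta_0,r)\},\ \sup\{r>0:b\in\mathcal U_\kappa(\alpha_0,r)\}\}$ with $\sup\emptyset=0$; $r_o(a,a)=\infty$. Logarithmic metrics (base $2$). Let $\rho(a,a)=0$; for $a\ne b$ let $\rho(a,b)=1$ if $r_o(a,b)<2$ and $\rho(a,b)=2^{-\lfloor\log_2 r_o(a,b)\rfloor+1}$ if $r_o(a,b)\ge2$. An exponent $\theta$ is admissible if $0<\theta\le 1/6$. A logarithmic metric $d^{X}_{o,\theta}$ is a metric on $\partial_\kappa X$ with $d^X_{o,\theta}\asymp\rho^\theta$ (equivalently $\asymp(1+r_o)^{-\theta}$); such metrics exist for admissible $\theta$ and induce the topology of $\partial_\kappa X$. Induced map. $\Phi_*$ sends the class of a geodesic ray $\alpha$ to the boundary point of $Y$ to which $\Phi(\alpha(t))$ converges as $t\to\infty$. A map $f$ is bi-Lipschitz if $L^{-1}d(x,x')\le d(f(x),f(x'))\le L\,d(x,x')$ for some $L\ge1$ and all $x,x'$. *)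

(* Defs.v *)
(* A map defined on an interval I of R is represented by a total function on R,
   of which only the values on I are ever inspected. *)
From HB Require Import structures.
From mathcomp Require Import all_boot all_order all_algebra.
From mathcomp Require Import all_classical all_reals all_analysis.

Set Implicit Arguments.
Unset Strict Implicit.
Unset Printing Implicit Defensive.

Import Order.TTheory GRing.Theory Num.Theory.
Import numFieldNormedType.Exports.

Local Open Scope classical_set_scope.
Local Open Scope ring_scope.

Definition nonneg {R : realType} : set R := [set t | 0 <= t].

Definition gromov_product {R : realType} {X : metricType R} (p x y : X) : R :=
  (mdist x p + mdist y p - mdist x y) / 2.

Definition hyperbolic {R : realType} (delta : R) (X : metricType R) : Prop :=
  0 <= delta /\
  forall p x y z : X,
    Num.min (gromov_product p x y) (gromov_product p y z) - delta
      <= gromov_product p x z.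

Definition proper_space {R : realType} (X : metricType R) : Prop :=
  forall (x : X) (r : R), compact [set y | mdist x y <= r].

Definition geodesic {R : realType} {X : metricType R} (I : set R)
    (gamma : R -> X) : Prop :=
  forall s t, I s -> I t -> mdist (gamma s) (gamma t) = `|s - t|.

Definition geodesic_space {R : realType} (X : metricType R) : Prop :=
  forall x y : X, exists gamma : R -> X,
    [/\ geodesic `[0, mdist x y] gamma,
        gamma 0 = x & gamma (mdist x y) = y].

Definition quasi_geodesic {R : realType} {X : metricType R} (I : set R)
    (q Q : R) (beta : R -> X) : Prop :=
  [/\ 1 <= q, 0 <= Q, {within I, continuous beta} &
      forall s t, I s -> I t ->
        q^-1 * `|s - t| - Q <= mdist (beta s) (beta t) <= q * `|s - t| + Q].

Definition geodesic_ray {R : realType} {X : metricType R} (o : X)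
    (alpha : R -> X) : Prop :=
  geodesic nonneg alpha /\ alpha 0 = o.

Definition quasi_geodesic_ray {R : realType} {X : metricType R} (o : X)
    (q Q : R) (beta : R -> X) : Prop :=
  quasi_geodesic nonneg q Q beta /\ beta 0 = o.

Definition ray_image {R : realType} {X : metricType R} (beta : R -> X) : set X :=
  beta @` nonneg.

(* The infimum is taken in \bar R, so that the distance to set0 is +oo. *)
Definition dist_to {R : realType} {X : metricType R} (Z : set X) (x : X) :
    \bar R :=
  ereal_inf [set (mdist x z)%:E | z in Z].

Definition neighborhood {R : realType} {X : metricType R} (Z : set X) (C : R) :
    set X :=
  [set x | (dist_to Z x <= C%:E)%E].

(* Two rays represent the same point of the visual boundary: their images are
   at finite Hausdorff distance. *)
Definition asymptotic {R : realType} {X : metricType R}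
    (alpha beta : R -> X) : Prop :=
  exists C : R,
    ray_image alpha `<=` neighborhood (ray_image beta) C /\
    ray_image beta `<=` neighborhood (ray_image alpha) C.

(* H is a stability constant for the Morse lemma, valid for all proper geodesic
   hyperbolic spaces at once since it depends on delta, q and Q only. *)
Definition morse_constant {R : realType} (H : R -> R -> R -> R) : Prop :=
  forall (X : metricType R) (delta q Q : R),
    proper_space X -> geodesic_space X -> hyperbolic delta X ->
    (forall (I : set R) (gamma : R -> X) (a b : R) (beta : R -> X),
       is_interval I -> geodesic I gamma ->
       a <= b -> quasi_geodesic `[a, b] q Q beta ->
       (gamma @` I) (beta a) -> (gamma @` I) (beta b) ->
       beta @` `[a, b] `<=` neighborhood (gamma @` I) (H delta q Q)) /\
    (forall (o : X) (alpha beta : R -> X),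
       geodesic_ray o alpha -> quasi_geodesic_ray o q Q beta ->
       asymptotic alpha beta ->
       ray_image beta `<=` neighborhood (ray_image alpha) (H delta q Q)).

(* Only the values of kappa on [0, +oo[ matter. *)
Definition sublinear_function {R : realType} (kappa : R -> R) : Prop :=
  [/\ forall r, 0 <= r -> 1 <= kappa r,
      forall r s, 0 <= r -> r <= s -> kappa r <= kappa s,
      @convex_function R R^o nonneg (fun r => - kappa r) &
      kappa r / r @[r --> +oo] --> (0 : R)].

Definition kappa_neighborhood {R : realType} {X : metricType R} (o : X)
    (kappa : R -> R) (Z : set X) (n : R) : set X :=
  [set x | (dist_to Z x <= (n * kappa (mdist o x))%:E)%E].

(* m is a proper map [1, +oo[ x [0, +oo[ -> [0, +oo[ (preimages of compact sets
   are compact). *)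
Definition proper_gauge {R : realType} (m : R * R -> R) : Prop :=
  (forall q Q, 1 <= q -> 0 <= Q -> 0 <= m (q, Q)) /\
  forall K : set R, K `<=` nonneg -> compact K ->
    compact [set p : R * R | [/\ 1 <= p.1, 0 <= p.2 & K (m p)]].

Definition kappa_morse {R : realType} {X : metricType R} (o : X)
    (kappa : R -> R) (Z : set X) : Prop :=
  closed Z /\
  exists m : R * R -> R, proper_gauge m /\
    forall (q Q a b : R) (beta : R -> X),
      a <= b -> quasi_geodesic `[a, b] q Q beta -> Z (beta a) -> Z (beta b) ->
      beta @` `[a, b] `<=` kappa_neighborhood o kappa Z (m (q, Q)).

(* For a quasi-geodesic ray from o and r > 0 the infimum is a minimum. *)
Definition hitting_time {R : realType} {X : metricType R} (o : X)
    (beta : R -> X) (r : R) : R :=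
  inf [set t | 0 <= t /\ mdist o (beta t) = r].

Definition hitting_point {R : realType} {X : metricType R} (o : X)
    (beta : R -> X) (r : R) : X :=
  beta (hitting_time o beta r).

Definition initial_part {R : realType} {X : metricType R} (o : X)
    (beta : R -> X) (r : R) : set X :=
  beta @` `[0, hitting_time o beta r].

Definition kappa_morse_rays {R : realType} {X : metricType R} (o : X)
    (kappa : R -> R) : set (R -> X) :=
  [set beta | (exists q Q, quasi_geodesic_ray o q Q beta) /\
              kappa_morse o kappa (ray_image beta)].

Definition sublinearly_close {R : realType} {X : metricType R} (o : X)
    (alpha beta : R -> X) : Prop :=
  mdist (hitting_point o alpha r) (hitting_point o beta r) / r
    @[r --> +oo] --> (0 : R).

Definition kappa_class {R : realType} {X : metricType R} (o : X)
    (kappa : R -> R) (beta : R -> X) : set (R -> X) :=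
  [set gamma | kappa_morse_rays o kappa gamma /\ sublinearly_close o beta gamma].

(* The points of the boundary are the equivalence classes themselves, as sets
   of rays; for [b : kappa_boundary o kappa], [val b beta] says that the ray
   beta belongs to the class b. *)
Definition kappa_boundary {R : realType} {X : metricType R} (o : X)
    (kappa : R -> R) : set (set (R -> X)) :=
  kappa_class o kappa @` kappa_morse_rays o kappa.

Definition geodesic_representatives {R : realType} {X : metricType R} (o : X)
    (kappa : R -> R) (rep : kappa_boundary o kappa -> R -> X) : Prop :=
  forall b, geodesic_ray o (rep b) /\ val b (rep b).

Definition morse_bound {R : realType} (H : R -> R -> R -> R) (delta q Q : R) : R :=
  Num.max q (Num.max Q
    (Num.max (H delta (3 * q) (3 * Q)) (3 * H delta q Q + 30 * delta))).

Definition kappa_open {R : realType} {X : metricType R} (o : X)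
    (kappa : R -> R) (M : R -> R -> R) (alpha0 : R -> X) (r : R) :
    set (kappa_boundary o kappa) :=
  [set b | forall (q Q : R) (beta : R -> X),
     val b beta -> quasi_geodesic_ray o q Q beta ->
     M q Q < r / (24 * kappa r) ->
     initial_part o beta r
       `<=` kappa_neighborhood o kappa (ray_image alpha0) (M q Q)].

(* [maxe 0] realizes the convention that the supremum of the empty set is 0. *)
Definition fellow_sup {R : realType} {X : metricType R} (o : X)
    (kappa : R -> R) (M : R -> R -> R) (rep : kappa_boundary o kappa -> R -> X)
    (a b : kappa_boundary o kappa) : \bar R :=
  maxe 0%E (ereal_sup
    [set r%:E | r in [set r | 0 < r /\ kappa_open M (rep b) r a]]).

Definition fellow_radius {R : realType} {X : metricType R} (o : X)
    (kappa : R -> R) (M : R -> R -> R) (rep : kappa_boundary o kappa -> R -> X)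
    (a b : kappa_boundary o kappa) : \bar R :=
  if `[< a = b >] then +oo%E
  else mine (fellow_sup M rep a b) (fellow_sup M rep b a).

(* The +oo case is the convention 2^(-oo) = 0; -oo is never a radius. *)
Definition radius_scale {R : realType} (r : \bar R) : R :=
  match r with
  | r%:E => if r < 2 then 1 else 2 ^ (- Num.floor (ln r / ln 2) + 1)
  | +oo%E => 0
  | -oo%E => 1
  end.

Definition log_gauge {R : realType} {X : metricType R} (o : X)
    (kappa : R -> R) (M : R -> R -> R) (rep : kappa_boundary o kappa -> R -> X)
    (a b : kappa_boundary o kappa) : R :=
  if `[< a = b >] then 0 else radius_scale (fellow_radius M rep a b).

Definition is_metric {R : realType} {T : Type} (d : T -> T -> R) : Prop :=
  [/\ forall x, d x x = 0,
      forall x y, d x y = 0 -> x = y,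
      forall x y, d x y = d y x &
      forall x y z, d x z <= d x y + d y z].

Definition admissible {R : realType} (theta : R) : Prop :=
  0 < theta <= 6^-1.

Definition logarithmic_metric {R : realType} {X : metricType R} (o : X)
    (kappa : R -> R) (M : R -> R -> R) (rep : kappa_boundary o kappa -> R -> X)
    (theta : R) (d : kappa_boundary o kappa -> kappa_boundary o kappa -> R) :
    Prop :=
  is_metric d /\
  exists c : R, 1 <= c /\
    forall a b, c^-1 * log_gauge M rep a b `^ theta <= d a b
                <= c * log_gauge M rep a b `^ theta.

Definition quasi_isometry {R : realType} {X Y : metricType R} (Phi : X -> Y) :
    Prop :=
  exists L C : R, [/\ 1 <= L, 0 <= C,
    forall x x', L^-1 * mdist x x' - C <= mdist (Phi x) (Phi x')
                 <= L * mdist x x' + C &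
    forall y, exists x, mdist y (Phi x) <= C].

(* Convergence to b in the Gromov compactification.  A point b of the
   kappa-boundary is identified with the point of the visual boundary
   represented by the geodesic rays that belong to b. *)
Definition converges_to_boundary {R : realType} {X : metricType R} (o : X)
    (kappa : R -> R) (x : R -> X) (b : kappa_boundary o kappa) : Prop :=
  exists beta : R -> X, [/\ geodesic_ray o beta, val b beta &
    gromov_product o (x p.1) (beta p.2)
      @[p --> (pinfty_nbhs R, pinfty_nbhs R)] --> +oo].

(* Limits in the compactification being unique, this determines f. *)
Definition induced_map {R : realType} {X Y : metricType R} (o : X) (o' : Y)
    (kappa : R -> R) (Phi : X -> Y)
    (f : kappa_boundary o kappa -> kappa_boundary o' kappa) : Prop :=
  forall (a : kappa_boundary o kappa) (alpha : R -> X),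
    geodesic_ray o alpha -> val a alpha ->
    converges_to_boundary (Phi \o alpha) (f a).

Definition bi_lipschitz {R : realType} {S T : Type} (dS : S -> S -> R)
    (dT : T -> T -> R) (f : S -> T) : Prop :=
  exists L : R, 1 <= L /\
    forall x x', L^-1 * dS x x' <= dT (f x) (f x') <= L * dS x x'.

(* Main.v *)
(* Up to multiplicative and additive constants, r_o(a, b) is the Gromov product
   of a and b: a ray b that stays in the kappa-neighborhood of a up to radius r
   is at distance at most r / 24 from a there, since kappa is sublinear, and
   conversely rays with Gromov product at least 2r are 4 delta-close up to
   radius 2r, so that stability of quasi-geodesics puts all quasi-geodesics of
   the class b, up to radius r, in the M-neighborhood of a.  Quasi-isometries
   distort Gromov products affinely: the image of a geodesic ray is uniformly
   close to the representative of the image point.  As the gauge rho is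
   comparable to 1 / (1 + r_o), an affine distortion of r_o is a bi-Lipschitz
   distortion of rho, hence of rho^theta.  With r_o(a, a) = +oo the same
   comparison gives the injectivity of the induced map. *)
Require Import Defs.
From mathcomp Require Import all_boot all_order all_algebra.
From mathcomp Require Import all_classical all_reals all_analysis.
From mathcomp Require Import ring lra.

Set Implicit Arguments.
Unset Strict Implicit.
Unset Printing Implicit Defensive.

Import Order.TTheory GRing.Theory Num.Theory.
Import numFieldNormedType.Exports.

Local Open Scope classical_set_scope.
Local Open Scope ring_scope.

(** * Metric preliminaries and geodesic rays *)

Lemma dist_mdist_le {R : realType} {X : metricType R} (p x y : X) :
  `|mdist p x - mdist p y| <= mdist x y.
Proof.
have h1 := metric_triangle p x y; have h2 := metric_triangle p y x.
rewrite (metric_sym y x) in h2.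
by rewrite ler_norml; lra.
Qed.

Lemma le_mdist_quad {R : realType} {X : metricType R} (x x' y' y : X) :
  mdist x y <= mdist x x' + mdist x' y' + mdist y' y.
Proof.
have h1 := metric_triangle x x' y; have h2 := metric_triangle x' y' y.
by lra.
Qed.

(** The infimum in [dist_to] need not be attained, so a nearby point of [Z] is found only up to a
    slack [e]. *)
Lemma neighborhoodP {R : realType} {X : metricType R} (Z : set X) (C e : R) x :
  0 < e -> neighborhood Z C x -> exists2 z, Z z & mdist x z < C + e.
Proof.
move=> e0 xZ.
have : (ereal_inf [set (mdist x z)%:E | z in Z] < (C + e)%:E)%E.
  by apply: le_lt_trans xZ _; rewrite lte_fin ltrDl.
move=> /ereal_inf_lt[_ [z Zz <-]]; rewrite lte_fin => xz.
by exists z.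
Qed.

Lemma dist_to_le {R : realType} {X : metricType R} (Z : set X) (x z : X) :
  Z z -> (dist_to Z x <= (mdist x z)%:E)%E.
Proof. by move=> Zz; apply: ereal_inf_lbound; exists z. Qed.

Lemma geodesic_ray_norm {R : realType} {X : metricType R} (o : X) alpha (t : R) :
  geodesic_ray o alpha -> 0 <= t -> mdist o (alpha t) = t.
Proof.
move=> [alphaG <-] t0; rewrite alphaG ?/nonneg //= ?sub0r ?normrN ?ger0_norm//.
Qed.

Lemma lipschitz_within_continuous {R : realType} {X : metricType R} (A : set R)
    (K : R) (f : R -> X) :
  (forall s t, A s -> A t -> mdist (f s) (f t) <= K * `|s - t|) ->
  {within A, continuous f}.
Proof.
move=> fK; apply/subspace_continuousP => x Ax.
apply/metricType_numDomainType.cvgrPdist_lt => e e0.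
pose K' := Num.max K 1.
have K'0 : 0 < K' by rewrite /K' lt_max ltr01 orbT.
have KK' : K <= K' by rewrite /K' le_max lexx.
have eK : 0 < e / K' by rewrite divr_gt0.
rewrite near_withinE; near=> t => At.
apply: le_lt_trans (fK _ _ Ax At) _.
apply: le_lt_trans (ler_wpM2r _ KK') _ => //.
rewrite mulrC -(ltr_pdivlMr _ _ K'0).
by near: t; exact: (nbhsx_ballx x (e / K')).
Unshelve. all: by end_near. Qed.

Lemma within_continuous_mdist {R : realType} {X : metricType R} (A : set R)
    (f : R -> X) (o : X) :
  {within A, continuous f} -> {within A, continuous (fun t => mdist o (f t))}.
Proof.
move=> fc; apply/subspace_continuousP => x Ax.
apply/cvgrPdist_lt => e e0.
move/subspace_continuousP : fc => /(_ x Ax).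
move=> /metricType_numDomainType.cvgrPdist_lt /(_ e e0).
by apply: filterS => t xt; apply: le_lt_trans (dist_mdist_le _ _ _) xt.
Qed.

Lemma geodesic_ray_quasi {R : realType} {X : metricType R} (o : X) alpha :
  geodesic_ray o alpha -> quasi_geodesic_ray o (1 : R) 0 alpha.
Proof.
move=> [alphaG alpha0]; split => //; split => //.
  apply: (@lipschitz_within_continuous _ _ _ 1) => s t s0 t0.
  by rewrite mul1r alphaG.
by move=> s t s0 t0; rewrite alphaG // invr1 !mul1r subr0 addr0 lexx.
Qed.

Lemma quasi_geodesic_sub {R : realType} {X : metricType R} (I J : set R)
    (q Q : R) (beta : R -> X) :
  J `<=` I -> quasi_geodesic I q Q beta -> quasi_geodesic J q Q beta.
Proof.
move=> JI [q1 Q0 betac betaq]; split => //.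
  exact: continuous_subspaceW betac.
by move=> s t /JI Is /JI It; exact: betaq.
Qed.

(** * Thinness and stability of quasi-geodesic rays *)

Lemma gromov_productC {R : realType} {X : metricType R} (p x y : X) :
  gromov_product p x y = gromov_product p y x.
Proof. by rewrite /gromov_product (metric_sym x y) (addrC (mdist x p)). Qed.

(** Since [p] and [p'] lie between [o] and the points [x] and [y], the products [(p|x)_o] and
    [(y|p')_o] equal [s]. Two uses of hyperbolicity give [(p|p')_o >= s - 2 * delta], and both
    points have norm [s]. *)
Lemma hyperbolic_thin {R : realType} {X : metricType R} (delta : R) (o x y p p' : X)
    (s : R) :
  hyperbolic delta X ->
  mdist o p = s -> mdist p x = mdist o x - s ->
  mdist o p' = s -> mdist p' y = mdist o y - s ->
  s <= gromov_product o x y -> mdist p p' <= 4 * delta.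
Proof.
move=> [d0 hyp] op px op' p'y sxy.
have h1 := hyp o p x y; have h2 := hyp o p y p'.
have px' : gromov_product o p x = s.
  rewrite /gromov_product (metric_sym p o) (metric_sym x o) op px; lra.
have py' : gromov_product o y p' = s.
  rewrite gromov_productC /gromov_product (metric_sym p' o) (metric_sym y o).
  rewrite op' p'y; lra.
have h3 : s - delta <= gromov_product o p y.
  by apply: le_trans h1; rewrite lerD2r px' le_min lexx.
have : s - delta - delta <= gromov_product o p p'.
  apply: le_trans h2; rewrite lerD2r py' le_min h3 /=.
  by rewrite gerBl.
rewrite /gromov_product (metric_sym p o) (metric_sym p' o) op op'; lra.
Qed.

Lemma rays_thin {R : realType} {X : metricType R} (delta : R) (o : X)
    (alpha beta : R -> X) (s u v : R) :
  hyperbolic delta X -> geodesic_ray o alpha -> geodesic_ray o beta ->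
  0 <= s -> 0 <= u -> 0 <= v ->
  s <= gromov_product o (alpha u) (beta v) -> mdist (alpha s) (beta s) <= 4 * delta.
Proof.
move=> hyp alphaG betaG s0 u0 v0 suv.
have ou := geodesic_ray_norm alphaG u0; have ov := geodesic_ray_norm betaG v0.
have os := geodesic_ray_norm alphaG s0; have os' := geodesic_ray_norm betaG s0.
have d1 := dist_mdist_le o (alpha u) (beta v); rewrite ou ov ler_norml in d1.
have suv' := suv.
rewrite /gromov_product (metric_sym _ o) (metric_sym _ o) ou ov in suv'.
(* A Gromov product is at most the norm of either point, so time [s] is not later than [u] and
   [v]. *)
have [su sv] : s <= u /\ s <= v by split; lra.
apply: (hyperbolic_thin hyp os _ os' _ suv).
- by rewrite ou (proj1 alphaG) // distrC ger0_norm ?subr_ge0.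
- by rewrite ov (proj1 betaG) // distrC ger0_norm ?subr_ge0.
Qed.
(** For late [T], the geodesic from [o] to [beta T] shadows [gamma] beyond the norm of [beta t]. The
    Morse lemma puts [beta t] near a point of this geodesic, and thinness carries that point to
    [gamma]. *)
Lemma quasi_ray_near_geodesic {R : realType} {X : metricType R} (delta : R)
    (H : R -> R -> R -> R) (o : X) (q Q : R) (beta gamma : R -> X) :
  proper_space X -> geodesic_space X -> hyperbolic delta X -> morse_constant H ->
  quasi_geodesic_ray o q Q beta -> geodesic_ray o gamma ->
  (forall N, exists T s,
     [/\ N <= T, 0 <= s & N <= gromov_product o (beta T) (gamma s)]) ->
  forall t e, 0 <= t -> 0 < e ->
  exists2 u, 0 <= u & mdist (beta t) (gamma u) <= H delta q Q + 4 * delta + e.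
Proof.
move=> Xp Xg Xh mH [betaQ beta0] gammaG far t e t0 e0.
(* The first bound places [beta t] on the segment up to [T]; the second dominates the norm [w] of
   the point found near [beta t]. *)
have [T [s [NT s0 Ns]]] :=
  far (Num.max t (mdist o (beta t) + H delta q Q + e)).
move: NT Ns; rewrite !ge_max => /andP[tT NT] /andP[_ Ns].
have [sigma [sigmaG sigma0 sigmaT]] := Xg o (beta T).
have D0 := mdist_ge0 o (beta T); set D := mdist o (beta T) in sigmaG sigmaT D0.
have betaT : quasi_geodesic `[0, T] q Q beta.
  by apply: quasi_geodesic_sub betaQ => x; rewrite /= in_itv /= => /andP[].
have [mX _] := mH X delta q Q Xp Xg Xh.
have I0 : (`[0, D]%classic : set R) 0 by rewrite /= in_itv /= lexx.
have ID : (`[0, D]%classic : set R) D by rewrite /= in_itv /= lexx andbT.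
have b0 : (sigma @` `[0, D]) (beta 0) by exists 0; rewrite // sigma0.
have bT : (sigma @` `[0, D]) (beta T) by exists D.
have := mX _ _ _ _ _ (@interval_is_interval _ `[0, D]) sigmaG
  (le_trans t0 tT) betaT b0 bT.
have It : (`[0, T]%classic : set R) t by rewrite /= in_itv /= t0.
move=> /(_ (beta t)) /(_ (ex_intro2 _ _ t It erefl)).
move=> /(neighborhoodP e0)[_ [w Iw <-] tw].
have /andP[w0 wD] : 0 <= w <= D by move: Iw; rewrite /= in_itv.
have ow : mdist o (sigma w) = w.
  by rewrite -{1}sigma0 sigmaG // sub0r normrN ger0_norm.
have wt := dist_mdist_le o (beta t) (sigma w).
rewrite ow ler_norml in wt.
have ws : w <= gromov_product o (beta T) (gamma s) by lra.
exists w => //.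
have gs := geodesic_ray_norm gammaG s0.
have wT : mdist (sigma w) (beta T) = mdist o (beta T) - w.
  by rewrite -sigmaT sigmaG // distrC ger0_norm ?subr_ge0// sigmaT.
have sw : w <= s.
  have := dist_mdist_le o (beta T) (gamma s); rewrite ler_norml gs.
  move: ws; rewrite /gromov_product (metric_sym _ o) (metric_sym _ o) gs; lra.
have wg : mdist (gamma w) (gamma s) = mdist o (gamma s) - w.
  by rewrite gs (proj1 gammaG) // distrC ger0_norm ?subr_ge0.
have := hyperbolic_thin Xh ow wT (geodesic_ray_norm gammaG w0) wg ws.
have := metric_triangle (beta t) (sigma w) (gamma w).
by lra.
Qed.

(** * Hitting times and divergence of rays within a class *)

Lemma hitting_time_ge0 {R : realType} {X : metricType R} (o : X) beta (r : R) :
  0 <= hitting_time o beta r.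
Proof.
rewrite /hitting_time; set A := [set t | _].
(* If the radius is never attained, [inf] takes its default value 0. *)
have [->|/set0P A0] := eqVneq A set0; first by rewrite inf0.
by apply: lb_le_inf => // x [].
Qed.

Lemma hitting_time_geodesic {R : realType} {X : metricType R} (o : X) alpha (r : R) :
  geodesic_ray o alpha -> 0 <= r -> hitting_time o alpha r = r.
Proof.
move=> alphaG r0; rewrite /hitting_time.
suff -> : [set t | 0 <= t /\ mdist o (alpha t) = r] = [set r] by rewrite inf1.
apply/seteqP; split => [t [t0]|t ->] /=; last by rewrite geodesic_ray_norm.
by rewrite geodesic_ray_norm.
Qed.

Lemma mdist_initial_part_le {R : realType} {X : metricType R} (o : X) (q Q : R)
    beta (r t : R) :
  quasi_geodesic_ray o q Q beta -> 0 <= r -> 0 <= t <= hitting_time o beta r ->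
  mdist o (beta t) <= r.
Proof.
move=> [[_ _ betac _] beta0] r0 /andP[t0 tr]; rewrite leNgt; apply/negP => rt.
have tc : {within `[0, t], continuous (fun s => mdist o (beta s))}.
  apply: within_continuous_mdist; apply: continuous_subspaceW betac => x.
  by rewrite /= in_itv /= => /andP[].
(* A norm above [r] at [t] forces the value [r] at some [c <= t]; the hitting time is at most [c],
   so [c = t], a contradiction. *)
have [|c /[!in_itv]/= /andP[c0 ct] cr] := IVT (v := r) t0 tc.
  by rewrite beta0 mdistxx ge_min r0 le_max (ltW rt) orbT.
have : hitting_time o beta r <= c.
  by apply: ge_inf; [exists 0 => x [] | split].
move=> rc; have ctE : c = t by apply/le_anti; rewrite ct (le_trans tr rc).
by rewrite ctE in cr; rewrite cr ltxx in rt.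
Qed.

(** Sublinear closeness becomes divergence of Gromov products: at a large radius [r] both hitting
    points are within [r / 4] of that of [gamma0], hence within [r / 2] of each other, and their
    product is at least [r / 2]. The norm of [beta T] is estimated from [gamma r]. *)
Lemma class_ray_diverges_along {R : realType} {X : metricType R} (o : X)
    (q Q : R) (gamma0 beta gamma : R -> X) :
  quasi_geodesic_ray o q Q beta -> geodesic_ray o gamma ->
  sublinearly_close o gamma0 beta -> sublinearly_close o gamma0 gamma ->
  forall N, exists T s,
    [/\ N <= T, 0 <= s & N <= gromov_product o (beta T) (gamma s)].
Proof.
move=> [[q1 Q0 _ betaQ] beta0] gammaG /cvgrPdist_lt cb /cvgrPdist_lt cg N.
have e0 : 0 < 4^-1 :> R by lra.
(* Half of this threshold exceeds both [N] and [q * |N| + Q], which bounds the norm of [beta] up to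
   time [|N|]. *)
have big : \forall r \near +oo, (2 * `|N| + 2 * q * `|N| + 2 * Q + 1 <= r)%R.
  by apply: nbhs_pinfty_ge; exact: num_real.
have [r [[]]] := @filter_ex _ (pinfty_nbhs R) _ _
  (filterI (filterI (cb _ e0) (cg _ e0)) big).
move=> db dg rN.
have qN : 0 <= q * `|N| by rewrite mulr_ge0 //; lra.
have N0 := normr_ge0 N.
have r0 : 0 < r by lra.
have {}db : mdist (hitting_point o gamma0 r) (hitting_point o beta r) < r / 4.
  move: db; rewrite sub0r normrN ger0_norm ?divr_ge0 ?mdist_ge0 ?(ltW r0) //.
  by rewrite ltr_pdivrMr // mulrC.
have {}dg : mdist (hitting_point o gamma0 r) (hitting_point o gamma r) < r / 4.
  move: dg; rewrite sub0r normrN ger0_norm ?divr_ge0 ?mdist_ge0 ?(ltW r0) //.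
  by rewrite ltr_pdivrMr // mulrC.
have gr := geodesic_ray_norm gammaG (ltW r0).
rewrite /hitting_point (hitting_time_geodesic gammaG (ltW r0)) in db dg.
set T := hitting_time o beta r in db.
have T0 : 0 <= T := hitting_time_ge0 o beta r.
have bg := metric_triangle (beta T) (gamma0 (hitting_time o gamma0 r)) (gamma r).
rewrite (metric_sym (beta T) (gamma0 _)) in bg.
have nb := dist_mdist_le o (beta T) (gamma r); rewrite gr ler_norml in nb.
exists T, r; split; last 2 first.
- exact: ltW.
- rewrite /gromov_product (metric_sym _ o) (metric_sym _ o) gr.
  by have := ler_norm N; lra.
have /andP[_] := betaQ 0 T (lexx 0) T0.
rewrite beta0 sub0r normrN ger0_norm // => oT.
have qNT : q * `|N| < q * T by lra.
rewrite ltr_pM2l in qNT; last by lra.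
by apply: le_trans (ler_norm N) (ltW qNT).
Qed.

(** * Fellow-traveling radius and Gromov products *)

(** A lower bound on the boundary Gromov product; one pair of parameters suffices, since the product
    is nondecreasing along geodesic rays. *)
Definition fellow_travel {R : realType} {X : metricType R} (o : X)
    (alpha beta : R -> X) (s : R) : Prop :=
  exists u v, [/\ 0 <= u, 0 <= v & s <= gromov_product o (alpha u) (beta v)].

Lemma fellow_travelC {R : realType} {X : metricType R} (o : X) alpha beta (s : R) :
  fellow_travel o alpha beta s -> fellow_travel o beta alpha s.
Proof.
by move=> [u [v [u0 v0 suv]]]; exists v, u; split; rewrite // gromov_productC.
Qed.

Lemma fellow_travel_refl {R : realType} {X : metricType R} (o : X) alpha (s : R) :
  geodesic_ray o alpha -> fellow_travel o alpha alpha s.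
Proof.
move=> alphaG; have s0 := normr_ge0 s; exists `|s|, `|s|; split => //.
rewrite /gromov_product (metric_sym _ o) (geodesic_ray_norm alphaG s0) mdistxx.
by have := ler_norm s; lra.
Qed.

(** Both rays are sublinearly close to the ray generating the class, which supplies the divergence
    that stability asks for. *)
Lemma class_quasi_ray_near {R : realType} {X : metricType R} (delta : R)
    (H : R -> R -> R -> R) (o : X) (kappa : R -> R) (b : kappa_boundary o kappa)
    (q Q : R) (beta gamma : R -> X) :
  proper_space X -> geodesic_space X -> hyperbolic delta X -> morse_constant H ->
  val b beta -> quasi_geodesic_ray o q Q beta ->
  val b gamma -> geodesic_ray o gamma ->
  forall t e, 0 <= t -> 0 < e ->
  exists2 u, 0 <= u & mdist (beta t) (gamma u) <= H delta q Q + 4 * delta + e.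
Proof.
move=> Xp Xg Xh mH bbeta betaQ bgamma gammaG t e.
apply: (quasi_ray_near_geodesic Xp Xg Xh mH betaQ gammaG).
have /set_mem [gamma0 _ bE] := valP b.
move: bbeta bgamma; rewrite -bE => -[_ cb] [_ cg].
exact: class_ray_diverges_along betaQ gammaG cb cg.
Qed.

(** The smallness of [M] against [r] keeps the point [beta0 w] near [beta t] below radius [2 * r],
    where [alpha0] and [beta0] are still [4 * delta]-close; hence twice the radius in the
    hypothesis. *)
Lemma fellow_travel_kappa_open {R : realType} {X : metricType R} (delta : R)
    (H : R -> R -> R -> R) (o : X) (kappa : R -> R)
    (b : kappa_boundary o kappa) (alpha0 beta0 : R -> X) (r : R) :
  proper_space X -> geodesic_space X -> hyperbolic delta X -> morse_constant H ->
  sublinear_function kappa ->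
  geodesic_ray o alpha0 -> geodesic_ray o beta0 -> val b beta0 ->
  0 < r -> fellow_travel o alpha0 beta0 (2 * r) ->
  kappa_open (morse_bound H delta) alpha0 r b.
Proof.
move=> Xp Xg Xh mH [k1 _ _ _] alphaG betaG bbeta0 r0 [u [v [u0 v0 ruv]]].
move=> q Q beta bbeta betaQ; set M := morse_bound _ _ _ _ => Mr.
move=> _ [t It <-]; have /andP[t0 tr] : 0 <= t <= hitting_time o beta r.
  by move: It; rewrite /= in_itv.
have tr' : mdist o (beta t) <= r.
  by apply: mdist_initial_part_le betaQ (ltW r0) _; rewrite t0.
have M1 : 1 <= M.
  by rewrite /M /morse_bound le_max; case: betaQ => -[->].
have MH : 3 * H delta q Q + 30 * delta <= M.
  by rewrite /M /morse_bound !le_max lexx !orbT.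
have d0 : 0 <= delta by case: Xh.
have e0 : 0 < 6^-1 :> R by lra.
have [w w0 tw] := class_quasi_ray_near Xp Xg Xh mH bbeta betaQ bbeta0 betaG t0 e0.
have dge0 := mdist_ge0 (beta t) (beta0 w).
have krge1 := k1 _ (ltW r0).
have Mr24 : 24 * M <= r.
  have k0 : 0 < 24 * kappa r by lra.
  move: Mr; rewrite ltr_pdivlMr // => Mr; apply: le_trans (ltW Mr).
  by rewrite mulrC ler_pM2l; lra.
have wn := dist_mdist_le o (beta t) (beta0 w).
rewrite (geodesic_ray_norm betaG w0) ler_norml in wn.
have wr : w <= 2 * r by lra.
have wab := rays_thin Xh alphaG betaG w0 u0 v0 (le_trans wr ruv).
have tri := metric_triangle (beta t) (beta0 w) (alpha0 w).
rewrite (metric_sym (alpha0 w)) in wab.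
(* The total is [H delta q Q + 8 * delta + 1/6], at most [M] because
   [3 * H delta q Q + 30 * delta <= M] and [1 <= M]. *)
have tM : mdist (beta t) (alpha0 w) <= M by lra.
apply: (le_trans (@dist_to_le _ _ _ _ (alpha0 w) _)); first by exists w.
rewrite lee_fin; apply: le_trans tM _.
by rewrite ler_peMr //; [lra | exact: k1 (mdist_ge0 _ _)].
Qed.

(** Beyond [R0] a radius passes the smallness test of [kappa_open]; for [M 1 0] this admits geodesic
    rays as test rays. *)
Lemma sublinear_eventually_small {R : realType} (kappa : R -> R) (M : R) :
  sublinear_function kappa ->
  exists2 R0, 0 <= R0 & forall r, R0 < r -> M < r / (24 * kappa r).
Proof.
move=> [k1 _ _ k0]; pose M' := `|M| + 1.
have M'0 : 0 < M' by rewrite /M' ltr_pwDr.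
have e0 : 0 < (24 * M')^-1 by rewrite invr_gt0; lra.
move/cvgrPdist_lt : k0 => /(_ _ e0) [A [_ Asmall]].
exists `|A| => // r Ar; have := ler_norm A; have := normr_ge0 A => A0 AA.
have r0 : 0 < r by lra.
have kr := k1 _ (ltW r0).
have := Asmall r (le_lt_trans AA Ar); rewrite /= sub0r normrN.
rewrite ger0_norm ?divr_ge0 ?(ltW r0)//; last by lra.
rewrite ltr_pdivrMr // mulrC ltr_pdivlMr; last by lra.
move=> krM; rewrite ltr_pdivlMr; last by lra.
have MM : M <= M' by rewrite /M'; have := ler_norm M; lra.
by apply: le_lt_trans (ler_wpM2r _ MM) _; lra.
Qed.

(** The ray [beta0] is itself a test ray, with constants [(1, 0)]. Its point at radius [r] is within
    [r / 24 + r / 4] of some [alpha0 u], which leaves a Gromov product of at least [17 * r / 24]. *)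
Lemma kappa_open_fellow_travel {R : realType} {X : metricType R}
    (o : X) (kappa : R -> R) (M : R -> R -> R)
    (b : kappa_boundary o kappa) (alpha0 beta0 : R -> X) (r : R) :
  geodesic_ray o alpha0 -> geodesic_ray o beta0 -> val b beta0 ->
  0 < r -> 1 <= kappa r -> M 1 0 < r / (24 * kappa r) ->
  kappa_open M alpha0 r b -> fellow_travel o alpha0 beta0 (r / 2).
Proof.
move=> alphaG betaG bbeta0 r0 kr Mr.
move=> /(_ 1 0 beta0 bbeta0 (geodesic_ray_quasi betaG) Mr (beta0 r)).
have inp : initial_part o beta0 r (beta0 r).
  exists r => //; rewrite hitting_time_geodesic ?(ltW r0) //=.
  by rewrite in_itv /= lexx (ltW r0).
move=> /(_ inp); rewrite /kappa_neighborhood /=.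
have nr := geodesic_ray_norm betaG (ltW r0); rewrite nr => near_r.
have [_ [u u0 <-] ru] := neighborhoodP (divr_gt0 r0 (ltr0n _ 4)) near_r.
have nu := geodesic_ray_norm alphaG u0.
have Mk : M 1 0 * kappa r < r / 24.
  move: Mr; rewrite !ltr_pdivlMr; lra.
exists u, r; split => //; first exact: ltW.
have := dist_mdist_le o (beta0 r) (alpha0 u); rewrite ler_norml nr nu.
rewrite /gromov_product (metric_sym _ o) (metric_sym _ o) nr nu (metric_sym (alpha0 u)).
lra.
Qed.

Lemma fellow_radius_ge0 {R : realType} {X : metricType R} (o : X) (kappa : R -> R)
    (M : R -> R -> R) (rep : kappa_boundary o kappa -> R -> X) a b :
  (0 <= fellow_radius M rep a b)%E.
Proof.
rewrite /fellow_radius; case: ifP => // _.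
by rewrite le_min /fellow_sup !le_max lexx.
Qed.

Lemma fellow_travel_fellow_radius {R : realType} {X : metricType R} (delta : R)
    (H : R -> R -> R -> R) (o : X) (kappa : R -> R)
    (rep : kappa_boundary o kappa -> R -> X) a b (r : R) :
  proper_space X -> geodesic_space X -> hyperbolic delta X -> morse_constant H ->
  sublinear_function kappa -> geodesic_representatives rep ->
  0 < r -> fellow_travel o (rep a) (rep b) (2 * r) ->
  (r%:E <= fellow_radius (morse_bound H delta) rep a b)%E.
Proof.
move=> Xp Xg Xh mH ks repG r0 abr.
have [aG bG] := (repG a, repG b).
rewrite /fellow_radius; case: ifP => [_|_]; first by rewrite leey.
rewrite le_min /fellow_sup !le_max; apply/andP; split; apply/orP; right;
  apply: ereal_sup_ubound; exists r => //; split => //.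
- exact: (fellow_travel_kappa_open Xp Xg Xh mH ks bG.1 aG.1 aG.2 r0
    (fellow_travelC abr)).
- exact: (fellow_travel_kappa_open Xp Xg Xh mH ks aG.1 bG.1 bG.2 r0 abr).
Qed.

Lemma fellow_radius_fellow_travel {R : realType} {X : metricType R} (o : X)
    (kappa : R -> R) (M : R -> R -> R) (rep : kappa_boundary o kappa -> R -> X) :
  sublinear_function kappa -> geodesic_representatives rep ->
  exists R0, forall a b r, (r%:E < fellow_radius M rep a b)%E ->
    fellow_travel o (rep a) (rep b) (r / 2 - R0).
Proof.
move=> ks repG; have [R0 R00 R0M] := sublinear_eventually_small (M 1 0) ks.
exists R0 => a b r; have [aG bG] := (repG a, repG b).
rewrite /fellow_radius; case: asboolP => [<- _|_].
  exact: fellow_travel_refl aG.1.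
rewrite lt_min /fellow_sup => /andP[_]; rewrite lt_max.
have [rR0 _|R0r] := leP r R0.
  exists 0, 0; split => //.
  by rewrite /gromov_product aG.1.2 bG.1.2 !mdistxx; lra.
case/orP => [|/ereal_sup_gt[_ [s [s0 sab] <-]]]; rewrite lte_fin.
  by move=> r0; lra.
move=> rs.
have ks1 : 1 <= kappa s by case: ks => k1 *; apply: k1; exact: ltW.
have Ms := R0M s (lt_trans R0r rs).
have [u [v [u0 v0 uv]]] :=
  kappa_open_fellow_travel aG.1 bG.1 bG.2 s0 ks1 Ms sab.
by exists u, v; split => //; lra.
Qed.

(** * The gauge as a function of the radius *)

(** With [2^n <= r <= 2^(n+1)] the gauge is [2 / 2^n], between [2 / r] and [4 / r]; the factor 6 is
    what [4 / r <= 6 / (1 + r)] requires at [r = 2]. *)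
Lemma radius_scale_bounds {R : realType} (r : R) : 0 <= r ->
  (1 + r)^-1 <= radius_scale r%:E <= 6 / (1 + r).
Proof.
move=> r0; rewrite /radius_scale; case: ifPn => [r2|].
  rewrite invf_le1 ?ler_pdivlMr; lra.
rewrite -leNgt => r2; set n := Num.floor _.
have ln20 : 0 < ln 2 :> R by rewrite ln_gt0 ?ltr1n.
have rE : 2 `^ (ln r / ln 2) = r.
  by rewrite /powR pnatr_eq0 /= divfK ?gt_eqF// lnK // posrE; lra.
have nr : 2 ^ n <= r.
  by rewrite -[leRHS]rE -powR_intmul //; apply: ler_powR; rewrite ?ler1n ?floor_le.
have rn : r <= 2 ^ n * 2.
  have -> : 2 ^ n * 2 = 2 ^ (n + 1) :> R by rewrite expfzDr ?pnatr_eq0// expr1z.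
  rewrite -[leLHS]rE -powR_intmul //.
  by apply: ler_powR; rewrite ?ler1n // ltW // floorD1_gt.
have n0 : 0 < 2 ^ n :> R by apply: exprz_gt0.
rewrite expfzDr ?pnatr_eq0// expr1z -invr_expz (mulrC _ 2).
move: (2 ^ n) n0 nr rn => y y0 yr ry.
apply/andP; split.
  by rewrite ler_pdivlMr // ler_pdivrMl; lra.
by rewrite ler_pdivlMr ?(mulrAC _ (_^-1)) ?ler_pdivrMr //; lra.
Qed.

Lemma radius_scale_ge0 {R : realType} (x : \bar R) : 0 <= radius_scale x.
Proof.
case: x => [r||] //=; case: ifP => // _.
by apply: exprz_ge0.
Qed.

(** For finite radii the affine bound yields [1 + x <= (1 + K + K * K) * (1 + x')]; the factor 6
    comes from replacing the gauge by [1 / (1 + r)]. Quantifying over finite [r < x] covers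
    [x = +oo] as well. *)
Lemma radius_scale_le {R : realType} (x x' : \bar R) (K : R) :
  1 <= K -> (0 <= x)%E -> (0 <= x')%E ->
  (forall r, (r%:E < x)%E -> ((r / K - K)%:E <= x')%E) ->
  radius_scale x' <= 6 * (1 + K + K * K) * radius_scale x.
Proof.
move=> K1 x0 x'0 xx'.
have K0 : 0 < K by lra.
have KK : 0 <= K * K by rewrite mulr_ge0; lra.
case: x' x'0 xx' => [r' r'0 xx'|_ _|//]; last first.
  by apply: mulr_ge0; [lra|exact: radius_scale_ge0].
case: x x0 xx' => [r r0 xx'|_ xx'|//]; last first.
  (* An infinite [x] excludes a finite [x']: this choice of [r] would give [r' + 1 <= r']. *)
  have := xx' ((r' + K + 1) * K) (ltey _); rewrite lee_fin mulfK ?gt_eqF//; lra.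
rewrite !lee_fin in r0 r'0.
have rr' : r / K - K <= r'.
  apply/ler_addgt0Pr => e e0; have eK := mulr_gt0 e0 K0.
  have : (((r - e * K) / K - K)%:E <= r'%:E)%E by apply: xx'; rewrite lte_fin; lra.
  rewrite lee_fin.
  have -> : (r - e * K) / K = r / K - e by rewrite mulrBl mulfK ?gt_eqF.
  by lra.
have {}rr' : r <= K * r' + K * K.
  by move: rr'; rewrite lerBlDr ler_pdivrMr // mulrDl mulrC.
have /andP[lo _] := radius_scale_bounds r0.
have /andP[_ hi] := radius_scale_bounds r'0.
apply: le_trans hi _.
apply: (@le_trans _ _ (6 * (1 + K + K * K) * (1 + r)^-1)); last first.
  by rewrite ler_pM2l //; lra.
rewrite ler_pdivlMr ?(mulrAC _ (_^-1)) ?ler_pdivrMr; [|lra..].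
have := mulr_ge0 KK r'0; have := mulr_ge0 (ltW K0) r'0; lra.
Qed.

(** * Interpolation of discrete quasi-geodesics *)

Lemma lipschitz_on_steps {R : realType} {X : metricType R} (K : R) (f : R -> X) :
  (forall n (s t : R), n%:R <= s <= n.+1%:R -> n%:R <= t <= n.+1%:R ->
     mdist (f s) (f t) <= K * `|s - t|) ->
  forall s t : R, 0 <= s -> 0 <= t -> mdist (f s) (f t) <= K * `|s - t|.
Proof.
move=> fK.
suff mono n (s t : R) : 0 <= s -> s <= t -> t <= n%:R ->
    mdist (f s) (f t) <= K * (t - s).
  have [N Nlt] : exists N : R -> nat, forall x, x <= (N x)%:R.
    by exists (fun x => (Num.truncn x).+1) => x; apply/ltW/truncnS_gt.
  move=> s t s0 t0; have [st|/ltW ts] := leP s t.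
    by rewrite distrC ger0_norm ?subr_ge0//; exact: mono (Nlt t).
  by rewrite metric_sym ger0_norm ?subr_ge0//; exact: mono (Nlt s).
elim: n s t => [|n IHn] s t s0 st tn.
  have -> : s = t by apply/le_anti; rewrite st (le_trans tn).
  by rewrite mdistxx subrr mulr0.
have [tn'|/ltW nt] := leP t n%:R; first exact: IHn.
have [ns|/ltW sn] := leP n%:R s.
  rewrite -[t - s]ger0_norm ?subr_ge0// distrC; apply: (fK n); last by rewrite nt.
  by rewrite ns (le_trans st tn).
have h1 := IHn _ _ s0 sn (lexx _).
have nn : n%:R <= (n%:R : R) <= n.+1%:R.
  by apply/andP; split; [exact: lexx|rewrite -natr1; lra].
have := fK n n%:R t nn; rewrite nt => /(_ tn).
rewrite distrC ger0_norm ?subr_ge0//.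
have := metric_triangle (f s) (f n%:R) (f t); lra.
Qed.

(** Quasi-geodesics must be continuous, which the image of a geodesic under a quasi-isometry need
    not be; hence integer samples are joined by geodesics, each run at constant speed at most
    [K]. *)
Lemma geodesic_interpolation {R : realType} {X : metricType R} (K : R)
    (x : nat -> X) :
  geodesic_space X -> (forall n, mdist (x n) (x n.+1) <= K) ->
  exists2 c : R -> X, forall n, c n%:R = x n &
    forall s t : R, 0 <= s -> 0 <= t -> mdist (c s) (c t) <= K * `|s - t|.
Proof.
move=> Xg xK.
have [g gP] := choice (fun n => Xg (x n) (x n.+1)).
pose c (t : R) := let n := Num.truncn t in g n ((t - n%:R) * mdist (x n) (x n.+1)).
have cn n : c n%:R = x n.
  by have [_ g0 _] := gP n; rewrite /c natrK subrr mul0r g0.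
exists c => //.
apply: lipschitz_on_steps => n.
(* At [t = n + 1] the truncation already jumps to [n + 1]; the formula persists because both pieces
   take the value [x n.+1] there. *)
have cE (t : R) : n%:R <= t <= n.+1%:R -> c t = g n ((t - n%:R) * mdist (x n) (x n.+1)).
  move=> /andP[nt]; rewrite le_eqVlt => /predU1P[->|tn].
    by rewrite cn -natrB// subSnn mul1r; have [_ _ ->] := gP n.
  by rewrite /c (truncn_def (n := n)) // nt tn.
move=> s t sn tn; rewrite !cE //; have [gG _ _] := gP n.
have D0 := mdist_ge0 (x n) (x n.+1).
have I (u : R) : n%:R <= u <= n.+1%:R ->
    `[0, mdist (x n) (x n.+1)]%classic ((u - n%:R) * mdist (x n) (x n.+1)).
  move=> /andP[nu un]; rewrite /= in_itv /= mulr_ge0 ?subr_ge0//=.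
  by apply: ler_piMl => //; rewrite -natr1 in un; lra.
rewrite gG; [|exact: I..].
rewrite -mulrBl normrM (ger0_norm D0) mulrC.
have -> : s - n%:R - (t - n%:R) = s - t by ring.
exact: ler_wpM2r.
Qed.

(** Rounding both parameters down moves the points by at most [2 * K] in total and changes [|s - t|]
    by at most 1, at a cost [q^-1 <= 1]. *)
Lemma quasi_geodesic_interpolation {R : realType} {X : metricType R} (q Q K : R)
    (x : nat -> X) :
  geodesic_space X -> 1 <= q -> 0 <= Q -> (forall n, mdist (x n) (x n.+1) <= K) ->
  (forall m n, q^-1 * `|m%:R - n%:R| - Q <= mdist (x m) (x n)) ->
  exists2 c : R -> X, forall n, c n%:R = x n &
    quasi_geodesic nonneg (Num.max q K) (Q + 2 * K + 1) c.
Proof.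
move=> Xg q1 Q0 xK xq; have [c cn cK] := geodesic_interpolation Xg xK.
have K0 : 0 <= K := le_trans (mdist_ge0 _ _) (xK 0%N).
exists c => //; split.
- by rewrite le_max q1.
- lra.
- by apply: (@lipschitz_within_continuous _ _ _ K) => s t; exact: cK.
move=> s t s0 t0; apply/andP; split; last first.
  have := cK s t s0 t0; have : K * `|s - t| <= Num.max q K * `|s - t|.
    by apply: ler_wpM2r => //; rewrite le_max lexx orbT.
  lra.
have near (u : R) : 0 <= u ->
    exists2 n : nat, 0 <= u - n%:R <= 1 & mdist (x n) (c u) <= K.
  move=> u0; have /andP[nu un] := truncn_itv u0.
  have un1 : 0 <= u - (Num.truncn u)%:R <= 1.
    by rewrite -natr1 in un; apply/andP; split; lra.
  exists (Num.truncn u) => //; rewrite -cn metric_sym.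
  apply: le_trans (cK _ _ _ _) _ => //.
  by case/andP: un1 => h0 h1; rewrite ger0_norm// -[leRHS]mulr1 ler_wpM2l.
have [m sm xm] := near s s0; have [n tn xn] := near t t0.
have qv : 0 < q^-1 <= 1 by rewrite invr_gt0 invf_le1; lra.
have mnst : `|s - t| <= `|m%:R - n%:R| + 1.
  have := ler_norm (m%:R - n%:R : R); have := ler_norm (- (m%:R - n%:R) : R).
  rewrite normrN ler_norml; lra.
have h1 : (Num.max q K)^-1 * `|s - t| <= q^-1 * (`|m%:R - n%:R| + 1).
  apply: ler_pM => //; first by rewrite invr_ge0 le_max; lra.
  by rewrite lef_pV2 ?posrE ?lt_max ?le_max ?lexx //; lra.
have := le_mdist_quad (x m) (c s) (c t) (x n).
rewrite (metric_sym (c t)); have := xq m n.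
rewrite mulrDr in h1; lra.
Qed.

(** * Images of geodesic rays under a quasi-isometry *)

(** The double limit is sampled at an integer time [n.+1], where [c] and [x] agree; time 0 is left
    free so that [c] can start at the basepoint. *)
Lemma converges_to_boundary_diverges_along {R : realType} {X : metricType R} (o : X)
    (kappa : R -> R) (x c : R -> X) (b : kappa_boundary o kappa) :
  (forall n, c n.+1%:R = x n.+1%:R) -> converges_to_boundary x b ->
  exists beta, [/\ geodesic_ray o beta, val b beta &
    forall N, exists T s,
      [/\ N <= T, 0 <= s & N <= gromov_product o (c T) (beta s)]].
Proof.
move=> cx [beta [betaG bbeta /cvgryPge far]].
exists beta; split=> // N.
have [[A B] [[a [_ aA]] [b0 [_ bB]]] AB] := far N.
have [n na] : exists n : nat, Num.max N a < n.+1%:R.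
  by exists (Num.truncn (Num.max N a)); exact: truncnS_gt.
move: na; rewrite gt_max => /andP[nN na].
have ble := ler_norm b0.
exists n.+1%:R, (`|b0| + 1); split; [exact: ltW|by rewrite addr_ge0|].
rewrite cx; apply: (AB (n.+1%:R, `|b0| + 1)); split => /=; first exact: aA.
by apply: bB; lra.
Qed.

(** Stability is used twice: the path through the image samples stays near the ray [beta] to which
    the image converges, and [beta] stays near the representative of its class. All constants are
    independent of [a] and [n]. *)
Lemma image_near_representative {R : realType} {X Y : metricType R} (o : X) (o' : Y)
    (delta : R) (H : R -> R -> R -> R) (kappa : R -> R) (Phi : X -> Y) (L C : R)
    (repX : kappa_boundary o kappa -> R -> X)
    (repY : kappa_boundary o' kappa -> R -> Y)
    (f : kappa_boundary o kappa -> kappa_boundary o' kappa) :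
  proper_space Y -> geodesic_space Y -> hyperbolic delta Y -> morse_constant H ->
  1 <= L -> 0 <= C ->
  (forall x x', L^-1 * mdist x x' - C <= mdist (Phi x) (Phi x')
                <= L * mdist x x' + C) ->
  geodesic_representatives repX -> geodesic_representatives repY ->
  induced_map Phi f ->
  exists K, forall a (n : nat), exists2 u, 0 <= u &
    mdist (Phi (repX a n%:R)) (repY (f a) u) <= K.
Proof.
move=> Yp Yg Yh mH L1 C0 PhiLC repXG repYG find.
pose D := mdist o' (Phi o).
have D0 : 0 <= D := mdist_ge0 _ _.
(* Each end of a pair of samples is displaced by at most [D], whence [C + 2 * D]; [S] bounds the
   distance of consecutive samples. *)
pose S := L + C + 2 * D; pose Q := C + 2 * D.
(* Two stability estimates with slack 1, plus [D] for the displaced first sample. *)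
exists (H delta (Num.max L S) (Q + 2 * S + 1) + 4 * delta + 1
        + (H delta 1 0 + 4 * delta + 1) + D) => a n.
have [aG bG] := (repXG a, repYG (f a)).
(* Moving the first point to o' makes the interpolated path a quasi-geodesic
   ray from o'. *)
pose y k := if k is 0%N then o' else Phi (repX a k%:R).
have yPhi k : mdist (y k) (Phi (repX a k%:R)) <= D.
  by case: k => [|k]; rewrite /y ?aG.1.2 // mdistxx.
have yy k l : L^-1 * `|k%:R - l%:R| - Q <= mdist (y k) (y l)
    <= L * `|k%:R - l%:R| + Q.
  have := PhiLC (repX a k%:R) (repX a l%:R).
  rewrite aG.1.1 /nonneg /= ?ler0n // => /andP[lo hi].
  have := le_mdist_quad (y k) (Phi (repX a k%:R)) (Phi (repX a l%:R)) (y l).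
  have := le_mdist_quad (Phi (repX a k%:R)) (y k) (y l) (Phi (repX a l%:R)).
  rewrite (metric_sym (Phi _) (y k)) (metric_sym (Phi _) (y l)).
  have := yPhi k; have := yPhi l; rewrite /Q => *; apply/andP; split; lra.
have yS k : mdist (y k) (y k.+1) <= S.
  have /andP[_] := yy k k.+1.
  by rewrite -natr1 opprD addNKr normrN1 mulr1 /S /Q; lra.
have Q0 : 0 <= Q by rewrite /Q; lra.
have [c cy cQ] := quasi_geodesic_interpolation Yg L1 Q0 yS
  (fun k l => proj1 (andP (yy k l))).
have cG : quasi_geodesic_ray o' (Num.max L S) (Q + 2 * S + 1) c.
  by split; rewrite // -[0]/(0%:R) cy.
have cx k : c k.+1%:R = (Phi \o repX a) k.+1%:R by rewrite cy.
have [beta [betaG bbeta far]] :=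
  converges_to_boundary_diverges_along cx (find a (repX a) aG.1 aG.2).
have [w w0 cw] := quasi_ray_near_geodesic Yp Yg Yh mH cG betaG far (ler0n _ n) ltr01.
have [u u0 wu] := class_quasi_ray_near Yp Yg Yh mH bbeta
  (geodesic_ray_quasi betaG) bG.2 bG.1 w0 ltr01.
exists u => //; rewrite cy in cw.
have := le_mdist_quad (Phi (repX a n%:R)) (y n) (beta w) (repY (f a) u).
rewrite (metric_sym (Phi _) (y n)); have := yPhi n; lra.
Qed.

(** * Affine distortion of Gromov products *)

(** At the integer part [n] of [s] the rays are [4 * delta]-close, so their images, and the points
    [alpha' u'] and [beta' v'] near these, are at bounded distance; the lower quasi-isometry bound
    makes [u'] and [v'] at least [s / L] up to constants. *)
Lemma fellow_travel_image {R : realType} {X Y : metricType R} (o : X) (o' : Y)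
    (delta : R) (Phi : X -> Y) (L C K : R) (alpha beta : R -> X)
    (alpha' beta' : R -> Y) (s : R) :
  hyperbolic delta X -> 1 <= L -> 0 <= C ->
  (forall x x', L^-1 * mdist x x' - C <= mdist (Phi x) (Phi x')
                <= L * mdist x x' + C) ->
  geodesic_ray o alpha -> geodesic_ray o beta ->
  geodesic_ray o' alpha' -> geodesic_ray o' beta' ->
  (forall n : nat, exists2 u, 0 <= u & mdist (Phi (alpha n%:R)) (alpha' u) <= K) ->
  (forall n : nat, exists2 u, 0 <= u & mdist (Phi (beta n%:R)) (beta' u) <= K) ->
  0 <= s -> fellow_travel o alpha beta s ->
  fellow_travel o' alpha' beta'
    (s / L - (1 + 2 * C + mdist o' (Phi o) + 2 * K + 2 * L * delta)).
Proof.
move=> Xh L1 C0 PhiLC alphaG betaG alphaG' betaG' alphaK betaK s0.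
move=> [u [v [u0 v0 suv]]].
have d0 : 0 <= delta by case: Xh.
have /andP[ns sn] := truncn_itv s0; set n := Num.truncn s in ns sn.
have n0 : 0 <= n%:R :> R := ler0n _ n.
have ab := rays_thin Xh alphaG betaG n0 u0 v0 (le_trans ns suv).
have [u' u'0 au] := alphaK n; have [v' v'0 bv] := betaK n.
have /andP[_ PhiAB] := PhiLC (alpha n%:R) (beta n%:R).
have LAB : L * mdist (alpha n%:R) (beta n%:R) <= L * (4 * delta).
  by rewrite ler_pM2l //; lra.
have far gamma gamma' w : geodesic_ray o gamma -> geodesic_ray o' gamma' ->
    0 <= w -> mdist (Phi (gamma n%:R)) (gamma' w) <= K ->
    s / L - 1 - C - mdist o' (Phi o) - K <= w.
  move=> gammaG gammaG' w0 gw.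
  have /andP[lo _] := PhiLC o (gamma n%:R).
  rewrite (geodesic_ray_norm gammaG n0) in lo.
  have t1 := metric_triangle (Phi o) o' (Phi (gamma n%:R)).
  have t2 := metric_triangle o' (gamma' w) (Phi (gamma n%:R)).
  rewrite (geodesic_ray_norm gammaG' w0) (metric_sym (gamma' w)) in t2.
  rewrite (metric_sym (Phi o) o') in t1.
  have L0 : 0 < L by lra.
  (* Rounding [s] down to [n] costs at most [1 / L <= 1]. *)
  have : s / L <= L^-1 * n%:R + 1.
    rewrite ler_pdivrMr // mulrDl mulrAC mulVf ?gt_eqF // mul1r.
    by rewrite -natr1 in sn; lra.
  lra.
have fu := far _ _ _ alphaG alphaG' u'0 au.
have fv := far _ _ _ betaG betaG' v'0 bv.
exists u', v'; split => //.
rewrite /gromov_product (metric_sym _ o') (metric_sym _ o').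
rewrite (geodesic_ray_norm alphaG' u'0) (geodesic_ray_norm betaG' v'0).
have := le_mdist_quad (alpha' u') (Phi (alpha n%:R)) (Phi (beta n%:R)) (beta' v').
rewrite (metric_sym (alpha' u') (Phi _)); lra.
Qed.

(* The norms of Phi (alpha n) tend to infinity with steps at most L + C. *)
Lemma image_at_norm {R : realType} {X Y : metricType R} (o : X) (o' : Y)
    (Phi : X -> Y) (L C : R) (alpha : R -> X) (s : R) :
  1 <= L -> 0 <= C ->
  (forall x x', L^-1 * mdist x x' - C <= mdist (Phi x) (Phi x')
                <= L * mdist x x' + C) ->
  geodesic_ray o alpha -> 0 <= s ->
  exists n : nat, `|mdist o' (Phi (alpha n%:R)) - s| <= L + C + mdist o' (Phi o).
Proof.
move=> L1 C0 PhiLC alphaG s0.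
have D0 := mdist_ge0 o' (Phi o).
pose P n := s <= mdist o' (Phi (alpha n%:R)).
have exP : exists n, P n.
  pose r := L * (s + C + mdist o' (Phi o)); exists (Num.truncn r).+1; rewrite /P.
  have rn := truncnS_gt r; set n := (Num.truncn r).+1 in rn *.
  have /andP[lo _] := PhiLC o (alpha n%:R).
  rewrite (geodesic_ray_norm alphaG (ler0n _ n)) in lo.
  have := metric_triangle (Phi o) o' (Phi (alpha n%:R)).
  have : s + C + mdist o' (Phi o) < L^-1 * n%:R.
    by rewrite ltr_pdivlMl //; lra.
  rewrite (metric_sym (Phi o) o'); lra.
case: (ex_minnP exP) => -[|n] Pn minn.
  exists 0%N; rewrite ger0_norm ?subr_ge0 // alphaG.2; lra.
exists n.+1; rewrite ger0_norm ?subr_ge0 //.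
have : mdist o' (Phi (alpha n%:R)) < s.
  by rewrite ltNge; apply/negP => /minn; rewrite ltnn.
have /andP[_] := PhiLC (alpha n%:R) (alpha n.+1%:R).
rewrite alphaG.1 /nonneg /= ?ler0n // -natr1 opprD addNKr normrN1 mulr1.
have := metric_triangle o' (Phi (alpha n%:R)) (Phi (alpha (n%:R + 1))); lra.
Qed.

(** Samples [alpha n] and [beta m] are chosen whose images have norm about [s], hence lie near
    [alpha' s] and [beta' s], which are [4 * delta]-close. The lower quasi-isometry bound then
    controls the distance of the samples, and the upper one bounds [n] and [m] from below. *)
Lemma fellow_travel_preimage {R : realType} {X Y : metricType R} (o : X) (o' : Y)
    (delta : R) (Phi : X -> Y) (L C K : R) (alpha beta : R -> X)
    (alpha' beta' : R -> Y) (s : R) :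
  hyperbolic delta Y -> 1 <= L -> 0 <= C ->
  (forall x x', L^-1 * mdist x x' - C <= mdist (Phi x) (Phi x')
                <= L * mdist x x' + C) ->
  geodesic_ray o alpha -> geodesic_ray o beta ->
  geodesic_ray o' alpha' -> geodesic_ray o' beta' ->
  (forall n : nat, exists2 u, 0 <= u & mdist (Phi (alpha n%:R)) (alpha' u) <= K) ->
  (forall n : nat, exists2 u, 0 <= u & mdist (Phi (beta n%:R)) (beta' u) <= K) ->
  0 <= s -> fellow_travel o' alpha' beta' s ->
  fellow_travel o alpha beta
    (s / L - (L + 2 * C + 2 * mdist o' (Phi o)
              + L * (4 * delta + 4 * K + 2 * (L + C + mdist o' (Phi o)) + C))).
Proof.
move=> Yh L1 C0 PhiLC alphaG betaG alphaG' betaG' alphaK betaK s0.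
move=> [u [v [u0 v0 suv]]].
have ab := rays_thin Yh alphaG' betaG' s0 u0 v0 suv.
have D0 := mdist_ge0 o' (Phi o); set D := mdist o' (Phi o) in D0 *.
have L0 : 0 < L by lra.
have near gamma gamma' : geodesic_ray o gamma -> geodesic_ray o' gamma' ->
    (forall n : nat, exists2 u, 0 <= u & mdist (Phi (gamma n%:R)) (gamma' u) <= K) ->
    exists n : nat, mdist (Phi (gamma n%:R)) (gamma' s) <= 2 * K + (L + C + D) /\
      s / L - (L + 2 * C + 2 * D) <= n%:R.
  move=> gammaG gammaG' gammaK.
  have [n ns] := image_at_norm o' L1 C0 PhiLC gammaG s0.
  exists n; have [w w0 nw] := gammaK n; rewrite ler_norml -/D in ns.
  have ndw := dist_mdist_le o' (Phi (gamma n%:R)) (gamma' w).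
  rewrite (geodesic_ray_norm gammaG' w0) ler_norml in ndw.
  have ws : mdist (gamma' w) (gamma' s) <= K + (L + C + D).
    by rewrite gammaG'.1 // ler_norml; lra.
  split; first by have := metric_triangle (Phi (gamma n%:R)) (gamma' w) (gamma' s); lra.
  have /andP[_] := PhiLC o (gamma n%:R).
  rewrite (geodesic_ray_norm gammaG (ler0n _ n)).
  have := metric_triangle o' (Phi o) (Phi (gamma n%:R)); rewrite -/D => h1 h2.
  rewrite lerBlDr ler_pdivrMr //.
  (* What is known is [s <= L * n + (L + 2 * C + 2 * D)]; since [1 <= L], dividing by [L] does not
     enlarge the constant. *)
  have : 0 <= (L - 1) * (L + 2 * C + 2 * D) by rewrite mulr_ge0; lra.
  lra.
have [n [an sn]] := near _ _ alphaG alphaG' alphaK.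
have [m [bm sm]] := near _ _ betaG betaG' betaK.
have /andP[lo _] := PhiLC (alpha n%:R) (beta m%:R).
have := le_mdist_quad (Phi (alpha n%:R)) (alpha' s) (beta' s) (Phi (beta m%:R)).
rewrite (metric_sym (beta' s) (Phi _)) => quad.
have nm : mdist (alpha n%:R) (beta m%:R)
    <= L * (4 * delta + 4 * K + 2 * (L + C + D) + C).
  by rewrite -ler_pdivrMl //; lra.
have nm0 := mdist_ge0 (alpha n%:R) (beta m%:R).
exists n%:R, m%:R; split => //.
rewrite /gromov_product (metric_sym _ o) (metric_sym _ o).
by rewrite (geodesic_ray_norm alphaG) // (geodesic_ray_norm betaG) //; lra.
Qed.

(** * From radii to gauges and metrics *)

(** The conventions on the diagonal agree: the radius is [+oo], whose scale is 0. *)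
Lemma log_gauge_scale {R : realType} {X : metricType R} (o : X) (kappa : R -> R)
    (M : R -> R -> R) (rep : kappa_boundary o kappa -> R -> X) a b :
  log_gauge M rep a b = radius_scale (fellow_radius M rep a b).
Proof. by rewrite /log_gauge /fellow_radius; case: asboolP. Qed.

(** The radius is turned into a Gromov product, distorted, and turned back. The two pairs of points
    are tied only by the distortion hypothesis, so both directions of the main estimate are
    instances. *)
Lemma log_gauge_le {R : realType} {X Y : metricType R} (o : X) (o' : Y)
    (delta : R) (H : R -> R -> R -> R) (M : R -> R -> R) (kappa : R -> R)
    (repX : kappa_boundary o kappa -> R -> X)
    (repY : kappa_boundary o' kappa -> R -> Y) (L c : R) :
  proper_space Y -> geodesic_space Y -> hyperbolic delta Y -> morse_constant H ->
  sublinear_function kappa ->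
  geodesic_representatives repX -> geodesic_representatives repY -> 1 <= L ->
  exists2 K, 1 <= K & forall a b a' b',
    (forall s, 0 <= s -> fellow_travel o (repX a) (repX b) s ->
       fellow_travel o' (repY a') (repY b') (s / L - c)) ->
    log_gauge (morse_bound H delta) repY a' b' <= K * log_gauge M repX a b.
Proof.
move=> Yp Yg Yh mH ks repXG repYG L1.
have [R0 R0P] := fellow_radius_fellow_travel M ks repXG.
(* Each passage between radius and Gromov product costs a factor 2, hence [4 * L]; the other terms
   dominate the additive losses. *)
pose K := 4 * L + `|R0| + `|c|.
have R00 := normr_ge0 R0; have c0 := normr_ge0 c.
have R0le := ler_norm R0; have cle := ler_norm c.
have K1 : 1 <= K by rewrite /K; lra.
have KK : 0 <= K * K by rewrite mulr_ge0; lra.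
exists (6 * (1 + K + K * K)); first lra.
move=> a b a' b' ab; rewrite !log_gauge_scale.
apply: radius_scale_le => // [||r rab]; [exact: fellow_radius_ge0..|].
have rad0 := fellow_radius_ge0 (morse_bound H delta) repY a' b'.
(* A nonpositive bound holds for any radius; otherwise [r > K * K], large enough for [r / 2 - R0] to
   be nonnegative. *)
have [r0|r0] := leP (r / K - K) 0.
  by apply: le_trans rad0; rewrite lee_fin.
have rK0 := r0.
have {}r0 : K * K < r by move: r0; rewrite subr_gt0 ltr_pdivlMr //; lra.
have L0 : 0 < L by lra.
have rpos : 0 < r by lra.
have KR : `|R0| + `|c| + 1 <= K by rewrite /K; lra.
have rK : r / K <= r / (4 * L).
  by rewrite ler_pM2l // lef_pV2 ?posrE /K; lra.
have s0 : 0 <= r / 2 - R0.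
  have : K * 4 <= K * K by rewrite ler_pM2l; [rewrite /K|]; lra.
  lra.
have := ab _ s0 (R0P _ _ _ rab).
have R0L : `|R0| / L <= `|R0| by rewrite ler_pdivrMr // ler_peMr.
have R0L' : R0 / L <= `|R0| / L by rewrite ler_pM2r ?invr_gt0.
have -> : (r / 2 - R0) / L - c = 2 * ((r / (4 * L)) - (R0 / L + c) / 2).
  by field; rewrite gt_eqF.
set w := _ - _ / 2 => travel.
have wK : r / K - K <= w by rewrite /w; lra.
have w0 : 0 < w := lt_le_trans rK0 wK.
by apply: le_trans (fellow_travel_fellow_radius Yp Yg Yh mH ks repYG w0 travel).
Qed.

(** One direction of the passage from gauges to metrics: each comparison of a metric with its gauge
    costs [c] or [c'], and raising [g' <= K * g] to the power [theta] costs the remaining factor. *)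
Lemma metric_powR_le {R : realType} (g g' d d' c c' K theta : R) :
  0 <= theta -> 0 <= g -> 0 <= g' -> 1 <= c -> 1 <= c' -> 1 <= K -> g' <= K * g ->
  c^-1 * g `^ theta <= d -> d' <= c' * g' `^ theta ->
  d' <= c * c' * K `^ theta * d.
Proof.
move=> t0 g0 g'0 c1 c'1 K1 gg' gd dg'.
have gg't : g' `^ theta <= K `^ theta * g `^ theta.
  rewrite -powRM //; last lra.
  by apply: ge0_ler_powR; rewrite ?nnegrE ?mulr_ge0 //; lra.
have {}gd : g `^ theta <= c * d.
  by rewrite -ler_pdivrMl //; lra.
apply: le_trans dg' _; apply: (@le_trans _ _ (c' * (K `^ theta * (c * d)))).
  rewrite ler_pM2l; last lra.
  by apply: le_trans gg't _; rewrite ler_wpM2l // powR_ge0.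
by have -> : c' * (K `^ theta * (c * d)) = c * c' * K `^ theta * d by ring.
Qed.

Theorem theorem2 (R : realType) (X Y : metricType R) (o : X) (o' : Y)
    (deltaX deltaY : R) (H : R -> R -> R -> R) (kappa : R -> R) (Phi : X -> Y)
    (repX : kappa_boundary o kappa -> R -> X)
    (repY : kappa_boundary o' kappa -> R -> Y)
    (theta : R)
    (dX : kappa_boundary o kappa -> kappa_boundary o kappa -> R)
    (dY : kappa_boundary o' kappa -> kappa_boundary o' kappa -> R)
    (Phi_star : kappa_boundary o kappa -> kappa_boundary o' kappa) :
  proper_space X -> geodesic_space X -> hyperbolic deltaX X ->
  proper_space Y -> geodesic_space Y -> hyperbolic deltaY Y ->
  sublinear_function kappa ->
  quasi_isometry Phi ->
  morse_constant H ->
  geodesic_representatives repX -> geodesic_representatives repY ->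
  admissible theta ->
  logarithmic_metric (morse_bound H deltaX) repX theta dX ->
  logarithmic_metric (morse_bound H deltaY) repY theta dY ->
  induced_map Phi Phi_star ->
  bi_lipschitz dX dY Phi_star.
Proof.
move=> Xp Xg Xh Yp Yg Yh ks [L [C [L1 C0 PhiLC _]]] mH repXG repYG /andP[theta0 _].
move=> [dXmetric [cX [cX1 dXg]]] [dYmetric [cY [cY1 dYg]]] PhiInd.
have [K KP] := image_near_representative Yp Yg Yh mH L1 C0 PhiLC repXG repYG PhiInd.
have [K1 K1ge forward] := log_gauge_le (morse_bound H deltaX)
  (1 + 2 * C + mdist o' (Phi o) + 2 * K + 2 * L * deltaX)
  Yp Yg Yh mH ks repXG repYG L1.
(* The same comparison with the spaces exchanged, for the lower bound. *)
have [K2 K2ge backward] := log_gauge_le (morse_bound H deltaY)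
  (L + 2 * C + 2 * mdist o' (Phi o)
   + L * (4 * deltaY + 4 * K + 2 * (L + C + mdist o' (Phi o)) + C))
  Xp Xg Xh mH ks repYG repXG L1.
pose gX := log_gauge (morse_bound H deltaX) repX.
pose gY := log_gauge (morse_bound H deltaY) repY.
have gX0 a b : 0 <= gX a b by rewrite /gX log_gauge_scale radius_scale_ge0.
have gY0 a b : 0 <= gY a b by rewrite /gY log_gauge_scale radius_scale_ge0.
(* The sum dominates both gauge constants, so a single bi-Lipschitz constant serves both
   directions. *)
pose K' := K1 + K2.
have gYX a b : gY (Phi_star a) (Phi_star b) <= K' * gX a b.
  apply: (@le_trans _ _ (K1 * gX a b)); last by rewrite ler_wpM2r // /K'; lra.
  apply: forward => s s0.
  by apply: (fellow_travel_image Xh L1 C0 PhiLC) => //;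
    [exact: (repXG _).1 | exact: (repXG _).1
    | exact: (repYG _).1 | exact: (repYG _).1].
have gXY a b : gX a b <= K' * gY (Phi_star a) (Phi_star b).
  apply: (@le_trans _ _ (K2 * gY (Phi_star a) (Phi_star b))).
    apply: backward => s s0.
    by apply: (fellow_travel_preimage Yh L1 C0 PhiLC) => //;
      [exact: (repXG _).1 | exact: (repXG _).1
      | exact: (repYG _).1 | exact: (repYG _).1].
  by rewrite ler_wpM2r // /K'; lra.
have K'1 : 1 <= K' by rewrite /K'; lra.
have Kt : 1 <= K' `^ theta.
  by rewrite -(powRr0 K') ler_powR // ltW.
exists (cX * cY * K' `^ theta); split.
  by rewrite -[1]mulr1 ler_pM // -[1]mulr1 ler_pM.
move=> a b.
have /andP[dXlo dXhi] := dXg a b.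
have /andP[dYlo dYhi] := dYg (Phi_star a) (Phi_star b).
apply/andP; split; last first.
  exact: metric_powR_le (ltW theta0) (gX0 _ _) (gY0 _ _) cX1 cY1 K'1
    (gYX a b) dXlo dYhi.
have prod0 : 0 < cX * cY * K' `^ theta.
  by rewrite !mulr_gt0 // (lt_le_trans ltr01).
rewrite (ler_pdivrMl _ _ prod0).
rewrite (mulrC cX).
exact: metric_powR_le (ltW theta0) (gY0 _ _) (gX0 _ _) cY1 cX1 K'1
  (gXY a b) dYlo dXhi.
Qed.
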